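(* For every integer $n\ge 0$, as polynomials in $x$, $$B_{n+1}^{L}(x)=x\sum_{m=0}^{n}\binom{n}{m}(n-m+1)!\,B_{m}^{L}(x).$$
   Context: For integers $n,k\ge 0$, the unsigned Lah number $L(n,k)$ is the number of ways a set of $n$ elements can be partitioned into $k$ nonempty linearly ordered subsets (so $L(0,0)=1$, $L(n,0)=0$ for $n\ge 1$, $L(n,k)=0$ for $k>n$, and $L(n,k)=\binom{n-1}{k-1}\frac{n!}{k!}$ for $n\ge k\ge 1$). The Lah-Bell polynomials are $B_n^L(x)=\sum_{l=0}^n L(n,l)x^l$ for $n\ge 0$. *)

(* Defs.v *)
From mathcomp Require Import all_boot all_order all_algebra.

Set Implicit Arguments.
Unset Strict Implicit.
Unset Printing Implicit Defensive.

Import GRing.Theory.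
Local Open Scope ring_scope.

(* A linearly ordered subset of T is encoded as the duplicate-free list of its
   elements in increasing order; such a list has length at most #|T|, so these
   lists all live in the finite type {bseq #|T| of T}. *)
Definition ordered_partition (T : finType) (A : {set {bseq #|T| of T}}) : bool :=
  [forall s in A, uniq s && (0 < size s)%N] &&
  [forall x : T, #|[set s in A | x \in s]| == 1%N].

Definition lah (n k : nat) : nat :=
  #|[set A : {set {bseq #|'I_n| of 'I_n}} | ordered_partition A & #|A| == k]|.

Definition lah_bell (n : nat) : {poly int} :=
  \sum_(l < n.+1) (lah n l)%:R *: 'X^l.

(* Main.v *)
Require Import Defs.
From mathcomp Require Import all_boot all_order all_algebra.

(** The polynomial identity is, coefficient by coefficient, the recurrence
    [L(n+1, k+1) = \sum_(m <= n) C(n, m) (n+1-m)! L(m, k)].  It comes from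
    looking at the block containing a chosen element [x0] of a set of [n+1]
    elements: the elements outside that block form a set [C] of some [m] among
    the [n] other elements, the block itself is one of the [(n+1-m)!] orderings
    of the complement of [C], and the other blocks form an ordered partition
    of [C] into [k] blocks ([card_lah_parts_rec]).

    The remaining blocks partition a subset and not a whole type, so the count
    is carried out for ordered partitions of an arbitrary subset [D] of a
    finite type.  That their number depends on [#|D|] only
    ([card_lah_parts]) needs no transport along bijections: the recurrence
    determines the count from cardinals, by induction on the number of
    blocks. *)

Set Implicit Arguments.
Unset Strict Implicit.

Import GRing.Theory.

(** * Ordered partitions of a subset *)

Section OrderedPartitionsOfSubset.

Variable T : finType.
Implicit Types (D C : {set T}) (s t : {bseq #|T| of T}).
Implicit Types (A : {set {bseq #|T| of T}}) (x : T).

Definition block_of D s : bool :=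
  [&& uniq s, (0 < size s)%N & [set x in s] \subset D].

Definition cover_mult A x : nat := #|[set s in A | x \in s]|.

Definition ordered_partition_of D A : bool :=
  [forall s in A, block_of D s] && [forall x in D, cover_mult A x == 1%N].

Definition lah_parts D (k : nat) : {set {set {bseq #|T| of T}}} :=
  [set A | ordered_partition_of D A & #|A| == k].

Lemma block_nonemptyP s : reflect (exists x, x \in s) (0 < size s)%N.
Proof.
apply: (iffP idP) => [|[x]]; rewrite -has_predT; first by case/hasP=> x; exists x.
by move=> xs; apply/hasP; exists x.
Qed.

Lemma ordered_partition_ofP D A :
  reflect ({in A, forall s, block_of D s} /\
           {in D, forall x, cover_mult A x = 1%N})
          (ordered_partition_of D A).
Proof.
apply: (iffP andP) => -[/forall_inP hA hD]; split=> //.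
  by move=> x xD; apply/eqP/(forall_inP hD).
by apply/forall_inP=> x xD; rewrite hD.
Qed.

Lemma ordered_partition_ofT A :
  ordered_partition_of setT A = ordered_partition A.
Proof.
congr (_ && _); first by apply: eq_forallb => s; rewrite /block_of subsetT andbT.
by apply: eq_forallb => x; rewrite inE.
Qed.

Lemma cover_multU1 s A x :
  s \notin A -> cover_mult (s |: A) x = ((x \in s) + cover_mult A x)%N.
Proof.
have cE B : cover_mult B x = (\sum_(t in B) (x \in t))%N.
  by rewrite /cover_mult -sum1dep_card big_mkcondr.
by move=> sA; rewrite !cE big_setU1.
Qed.

Lemma cover_mult_gt0 s A x : s \in A -> x \in s -> (0 < cover_mult A x)%N.
Proof. by move=> sA xs; apply/card_gt0P; exists s; rewrite inE sA. Qed.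

Lemma mem_block_of D s x : block_of D s -> x \in s -> x \in D.
Proof. by case/and3P=> _ _ /subsetP sD xs; apply: sD; rewrite inE. Qed.

(** The blocks other than [s] avoid the elements of [s] because each of these
    is already covered once. *)
Lemma ordered_partition_ofU1 D s A : block_of D s -> s \notin A ->
  ordered_partition_of D (s |: A) =
  ordered_partition_of (D :\: [set x in s]) A.
Proof.
move=> bs sA; apply/ordered_partition_ofP/ordered_partition_ofP => -[hA hD].
  split=> [t tA | x].
    have bt : block_of D t by apply: hA; rewrite !inE tA orbT.
    case/and3P: (bt) => ut t0 tD; rewrite /block_of ut t0.
    apply/subsetP=> x; rewrite !inE => xt; rewrite (mem_block_of bt xt) andbT.
    apply/negP=> xs; have := hD x (mem_block_of bt xt).
    by have := cover_mult_gt0 tA xt; rewrite cover_multU1 // xs; case: cover_mult.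
  rewrite !inE => /andP[xs xD].
  by have := hD x xD; rewrite cover_multU1 // (negbTE xs).
split=> [t | x xD].
  rewrite !inE => /predU1P[-> // | /hA /and3P[ut t0 tD]].
  by rewrite /block_of ut t0 (subset_trans tD) ?subsetDl.
rewrite cover_multU1 //; have [xs | xs] := boolP (x \in s); last first.
  by rewrite hD // !inE xs.
apply/eqP; rewrite eqSS cards_eq0; apply/eqP/setP=> t; rewrite !inE.
apply/negP=> /andP[tA xt].
by have := mem_block_of (hA t tA) xt; rewrite !inE xs.
Qed.

(** Adding [s] is a bijection from the partitions of what [s] leaves over onto
    the partitions having [s] as a block. *)
Lemma card_lah_parts_block D s k : block_of D s ->
  #|[set A in lah_parts D k.+1 | s \in A]| =
  #|lah_parts (D :\: [set x in s]) k|.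
Proof.
move=> bs.
have notin A : A \in lah_parts (D :\: [set x in s]) k -> s \notin A.
  rewrite inE => /andP[/ordered_partition_ofP[hA _] _].
  apply/negP=> /hA bs'; case/and3P: bs => _ /block_nonemptyP[x xs] _.
  by have := mem_block_of bs' xs; rewrite !inE xs.
rewrite -[RHS](card_in_imset (f := fun A => s |: A)); last first.
  by move=> A B /notin sA /notin sB eAB; rewrite -(setU1K sA) eAB setU1K.
apply: eq_card => A; apply/idP/imsetP => [| [B hB ->]].
  rewrite 2!inE => /andP[/andP[pA cA] sA]; exists (A :\ s); last by rewrite setD1K.
  rewrite inE -ordered_partition_ofU1 ?setD11 // setD1K // pA.
  by rewrite (cardsD1 s) sA in cA.
have sB := notin B hB; move: hB; rewrite !inE eqxx andbT.
by rewrite ordered_partition_ofU1 // cardsU1 sB.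
Qed.

Lemma card_orderings D :
  #|[set s : {bseq #|T| of T} | uniq s & [set x in s] == D]| = #|D|`!.
Proof.
rewrite cardE [#|D|]cardE -(size_permutations (enum_uniq D)) -(size_map val).
apply/perm_size/uniq_perm; rewrite ?permutations_uniq //.
  by rewrite (map_inj_uniq val_inj) enum_uniq.
move=> u; rewrite mem_permutations; apply/mapP/idP => [[s] | pu].
  rewrite mem_enum inE => /andP[us /eqP <-] ->.
  by apply: uniq_perm; rewrite ?enum_uniq // => x; rewrite mem_enum inE.
have uu : uniq u by rewrite (perm_uniq pu) enum_uniq.
have su : (size u <= #|T|)%N by rewrite -(card_uniqP uu) max_card.
exists (Bseq su) => //; rewrite mem_enum inE uu /=; apply/eqP/setP=> x.
by rewrite inE (perm_mem pu) mem_enum.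
Qed.

(** Each partition is counted at its unique block containing [x0]; these
    blocks are then sorted according to the set [C] that they leave over. *)
Lemma card_lah_parts_rec D x0 k : x0 \in D ->
  #|lah_parts D k.+1| =
  (\sum_(C : {set T} | C \subset D :\ x0) (#|D| - #|C|)`! * #|lah_parts C k|)%N.
Proof.
move=> x0D.
transitivity (\sum_(A in lah_parts D k.+1)
                \sum_(s | block_of D s && (x0 \in s)) (s \in A))%N.
  rewrite -sum1_card; apply: eq_bigr => A.
  rewrite inE => /andP[/ordered_partition_ofP[hA hD] _].
  rewrite -(hD x0 x0D) /cover_mult -sum1dep_card.
  rewrite [RHS](eq_bigr (fun s => if s \in A then 1 else 0)%N); last first.
    by move=> s _; case: (s \in A).
  rewrite -big_mkcondr; apply: eq_bigl => s.
  by case: (boolP (s \in A)) => [/hA -> | _]; rewrite ?andbF ?andbT.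
rewrite exchange_big /=.
under eq_bigr => s /andP[bs _].
  rewrite (eq_bigr (fun A => if s \in A then 1 else 0)%N); last first.
    by move=> A _; case: (s \in A).
  rewrite -big_mkcondr sum1dep_card card_lah_parts_block //.
over.
rewrite (partition_big (fun s : {bseq #|T| of T} => D :\: [set x in s])
           (fun C => C \subset D :\ x0)) /=; last first.
  move=> s /andP[_ x0s]; apply/subsetP=> x; rewrite !inE => /andP[xs ->].
  by rewrite andbT; apply: contraNneq xs => ->.
apply: eq_bigr => C CD.
rewrite (eq_bigr (fun=> #|lah_parts C k|)); last by move=> s /andP[_ /eqP->].
have sCD : C \subset D by rewrite (subset_trans CD) ?subD1set.
rewrite sum_nat_cond_const; congr (_ * _)%N.
have -> : (#|D| - #|C|)%N = #|D :\: C| by rewrite cardsD (setIidPr sCD).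
rewrite -card_orderings; apply: eq_card => s; rewrite !inE.
(* For subsets of D, leaving over C means having D :\: C as set of elements. *)
apply/idP/idP=> [/andP[/andP[/and3P[us _ sD] _] /eqP <-] | /andP[us /eqP es]].
  by rewrite us setDDr setDv set0U (setIidPr sD) eqxx.
have x0s : x0 \in s.
  have : x0 \in D :\: C.
    rewrite inE x0D andbT; apply: contraL CD => x0C.
    by apply/subsetPn; exists x0; rewrite ?inE ?eqxx.
  by rewrite -es inE.
rewrite x0s /block_of us es subsetDl setDDr setDv set0U (setIidPr sCD) eqxx !andbT.
by apply/block_nonemptyP; exists x0.
Qed.

Lemma sum_subset_card (E : {set T}) (G : nat -> nat) :
  (\sum_(C : {set T} | C \subset E) G #|C| =
   \sum_(m < #|E|.+1) 'C(#|E|, m) * G m)%N.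
Proof.
rewrite (partition_big (fun C : {set T} => inord #|C| : 'I_#|E|.+1) xpredT) //=.
apply: eq_bigr => m _; rewrite -cards_draws -sum_nat_const.
have cE (C : {set T}) : C \subset E -> (inord #|C| == m) = (#|C| == m).
  by move=> CE; rewrite -val_eqE /= inordK // ltnS subset_leq_card.
apply: eq_big => [C | C /andP[CE]]; last by rewrite cE // => /eqP->.
by rewrite inE; case: (boolP (C \subset E)) => // /cE ->.
Qed.

(** If the count for [k] blocks depends only on the cardinal, then so does the
    count for [k.+1]; stating this for an arbitrary [F] lets the same formula
    serve two different ambient types. *)
Lemma card_lah_parts_rec_card D k (F : nat -> nat) :
  D != set0 -> (forall C : {set T}, #|lah_parts C k| = F #|C|) ->
  #|lah_parts D k.+1| =
  (\sum_(m < #|D|) 'C(#|D|.-1, m) * ((#|D| - m)`! * F m))%N.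
Proof.
case/set0Pn=> x0 x0D hF; rewrite (card_lah_parts_rec k x0D).
under eq_bigr => C _ do rewrite hF.
rewrite (sum_subset_card _ (fun m => (#|D| - m)`! * F m)%N).
by rewrite [#|D|](cardsD1 x0) x0D.
Qed.

Lemma card_lah_parts0 D : #|lah_parts D 0| = (#|D| == 0)%N.
Proof.
have [D0 | /set0Pn[x xD]] := altP (D =P set0).
  rewrite D0 cards0 -[RHS]/1%N -(cards1 (@set0 {bseq #|T| of T})).
  apply: eq_card => A; rewrite !inE cards_eq0 andbC.
  case: eqP => [-> | //].
  by apply/ordered_partition_ofP; split=> [s|x]; rewrite inE.
rewrite (cardsD1 x) xD; apply/eqP; rewrite cards_eq0; apply/eqP/setP=> A.
rewrite !inE cards_eq0; apply/negP=> /andP[/ordered_partition_ofP[_ hD] /eqP eA].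
have /card_gt0P[s] : (0 < cover_mult A x)%N by rewrite hD.
by rewrite eA !inE.
Qed.

Lemma card_lah_parts_empty D k : #|D| = 0%N -> #|lah_parts D k.+1| = 0%N.
Proof.
move/cards0_eq->; apply/eqP; rewrite cards_eq0; apply/eqP/setP=> A; rewrite !inE.
apply/negP=> /andP[/ordered_partition_ofP[hA _] cA].
have /card_gt0P[s sA] : (0 < #|A|)%N by rewrite (eqP cA).
have bs := hA s sA; case/and3P: (bs) => _ /block_nonemptyP[x xs] _.
by have := mem_block_of bs xs; rewrite inE.
Qed.

End OrderedPartitionsOfSubset.

(** * Lah numbers *)

Lemma lahE n k : lah n k = #|lah_parts [set: 'I_n] k|.
Proof. by apply: eq_card => A; rewrite !inE ordered_partition_ofT. Qed.

(** Both sides obey a recurrence that mentions cardinals only, hence agree by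
    induction on [k]. *)
Lemma card_lah_parts k (T : finType) (D : {set T}) :
  #|lah_parts D k| = lah #|D| k.
Proof.
elim: k => [|k IHk] in T D *.
  by rewrite lahE !card_lah_parts0 cardsT card_ord.
rewrite lahE; have [-> | D0] := altP (D =P set0).
  by rewrite !card_lah_parts_empty // ?cardsT ?card_ord cards0.
have I0 : [set: 'I_#|D|] != set0.
  by rewrite -cards_eq0 cardsT card_ord cards_eq0.
rewrite (card_lah_parts_rec_card (F := lah^~ k) D0 (IHk T)).
by rewrite (card_lah_parts_rec_card (F := lah^~ k) I0 (IHk _)) cardsT card_ord.
Qed.

Lemma lahS n k :
  lah n.+1 k.+1 = (\sum_(m < n.+1) 'C(n, m) * (n - m + 1)`! * lah m k)%N.
Proof.
have I0 : [set: 'I_n.+1] != set0 by rewrite -cards_eq0 cardsT card_ord.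
rewrite lahE (card_lah_parts_rec_card (F := lah^~ k) I0 (@card_lah_parts k _)).
rewrite cardsT card_ord.
by apply: eq_bigr => m _; rewrite mulnA addn1 subSn // -ltnS.
Qed.

Lemma lahn0 n : lah n.+1 0 = 0%N.
Proof. by rewrite lahE card_lah_parts0 cardsT card_ord. Qed.

Lemma lah_small n k : (n < k)%N -> lah n k = 0%N.
Proof.
elim: k n => [//|k IHk] [|n] nk.
  by rewrite lahE card_lah_parts_empty // cardsT card_ord.
rewrite lahS big1 // => m _; rewrite IHk ?muln0 //.
exact: leq_trans (ltn_ord m) nk.
Qed.

(** * Lah-Bell polynomials *)

Local Open Scope ring_scope.

Lemma lah_bell_widen n m : (m <= n)%N ->
  lah_bell m = \sum_(l < n.+1) (lah m l)%:R *: 'X^l.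
Proof.
move=> mn; rewrite /lah_bell (big_ord_widen n.+1 (fun l => (lah m l)%:R *: 'X^l)) //.
rewrite big_mkcond; apply: eq_bigr => l _.
by case: ltnP => // ml; rewrite lah_small // scale0r.
Qed.

Theorem theorem9 (n : nat) :
  lah_bell n.+1 =
  'X * \sum_(0 <= m < n.+1) ('C(n, m) * (n - m + 1)`!)%:R *: lah_bell m.
Proof.
rewrite /lah_bell big_ord_recl lahn0 scale0r add0r big_mkord.
under [in RHS]eq_bigr => m _ do
  rewrite -/(lah_bell m) (@lah_bell_widen n) -1?ltnS // scaler_sumr.
rewrite exchange_big mulr_sumr; apply: eq_bigr => l _ /=.
rewrite lahS natr_sum scaler_suml mulr_sumr; apply: eq_bigr => m _.
by rewrite scalerA -natrM -scalerAr -exprS.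
Qed.
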